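(* Let $(X,f,x_0)$ be a counting system and let $\#$ be the unique iterator for $(X,f,x_0)$. If $A$ and $B$ are finite sets with $B \approx A$ then $\#(B) = \#(A)$.
   Context: For a set $A$ let $\mathcal{P}(A)$ denote its power set. A subset $\mathcal{K} \subset \mathcal{P}(A)$ is an inductive system in $\mathcal{P}(A)$ if $\varnothing \in \mathcal{K}$ and $B \cup \{a\} \in \mathcal{K}$ for all $B \in \mathcal{K}$ and $a \in A \setminus B$. A set $A$ is finite if $\mathcal{P}(A)$ itself is the only inductive system in $\mathcal{P}(A)$. Write $A \approx B$ if there exists a bijective mapping $h : A \to B$. A counting system is a triple $(X,f,x_0)$ with $X$ a set, $f : X \to X$ a mapping and $x_0 \in X$. An iterator for $(X,f,x_0)$ is an assignment $A \mapsto \#(A)$ of an element of $X$ to each finite set $A$ such that $\#(\varnothing) = x_0$ and $\#(A \cup \{a\}) = f(\#(A))$ whenever $A$ is a finite set and $a \notin A$. Each counting system has a unique iterator. *)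

(* Defs.v *)
From mathcomp Require Import all_boot.
From mathcomp Require Import mathcomp_extra boolp classical_sets functions cardinality.

Set Implicit Arguments.
Unset Strict Implicit.
Unset Printing Implicit Defensive.

Local Open Scope classical_set_scope.

(* A set is a subset [A : set T] of an arbitrary type [T], and [A #= B] (also
   for subsets of different types) states that there is a bijection from the
   subtype of the elements of [A] to that of the elements of [B]. *)

Definition power_set (T : Type) (A : set T) : set (set T) :=
  [set B | B `<=` A].

Definition inductive_system (T : Type) (A : set T) (K : set (set T)) : Prop :=
  [/\ K `<=` power_set A,
      K set0 &
      forall (B : set T) (a : T), K B -> (A `\` B) a -> K (B `|` [set a])].

(* Not the library's [finite_set], which is defined by a bijection with an
   initial segment of [nat]. *)
Definition is_finite (T : Type) (A : set T) : Prop :=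
  forall K : set (set T), inductive_system A K <-> K = power_set A.

Lemma inductive_power_set (T : Type) (A : set T) :
  inductive_system A (power_set A).
Proof.
by split=> // B a BA [Aa _] x [/BA //|->].
Qed.

Lemma is_finite_set0 (T : Type) : is_finite (@set0 T).
Proof.
move=> K; split=> [[K0 Ks _] | ->]; last exact: inductive_power_set.
by apply/seteqP; split=> // B; rewrite /power_set /= subset0 => ->.
Qed.

Lemma is_finite_setU1 (T : Type) (A : set T) (a : T) :
  is_finite A -> is_finite (A `|` [set a]).
Proof.
move=> finA K; split=> [[KP K0 KS] | ->]; last exact: inductive_power_set.
have [Aa|nAa] := pselect (A a).
  have E : A `|` [set a] = A by apply/seteqP; split=> [x [//|->//]|x]; left.
  by rewrite E in KP KS *; apply/(finA K).
pose K1 : set (set T) := [set B | [/\ B `<=` A, K B & K (B `|` [set a])]].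
have E1 : K1 = power_set A.
  apply/(finA K1); split.
  - by move=> B [].
  - split=> //; apply: KS => //; split=> //; by right.
  - move=> B b [BA KB KBa] [Ab nBb]; split.
    + by move=> x [/BA//|->].
    + by apply: KS => //; split=> //; left.
    + rewrite setUAC; apply: KS => //; split; first by left.
      by case=> // ba; apply: nAa; rewrite -ba.
apply/seteqP; split=> // B BP.
have : K1 (B `&` A) by rewrite E1 => x [].
have [Ba|nBa] := pselect (B a) => -[_ KB KBa].
  have -> : B = B `&` A `|` [set a].
    by apply/seteqP; split=> [x Bx|x [[]//|->//]]; case: (BP x Bx); [left|right].
  by [].
suff -> : B = B `&` A by [].
apply/seteqP; split=> [x Bx|x []//]; split=> //.
by case: (BP x Bx) => // xa; case: nBa; rewrite -xa.
Qed.

Record counting_system := CountingSystem {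
  carrier : Type;
  succ_map : carrier -> carrier;
  base : carrier }.

(* An element of [X] for each finite subset of each type. *)
Definition assignment (X : Type) :=
  forall (T : Type) (A : set T), is_finite A -> X.

Definition is_iterator (S : counting_system) (num : assignment (carrier S)) :
    Prop :=
  (forall T : Type, num T set0 (@is_finite_set0 T) = base S) /\
  (forall (T : Type) (A : set T) (finA : is_finite A) (a : T), ~ A a ->
     num T (A `|` [set a]) (is_finite_setU1 a finA) =
     succ_map (num T A finA)).

(* Main.v *)
Require Import Defs.
From mathcomp Require Import all_boot.
From mathcomp Require Import mathcomp_extra boolp classical_sets functions cardinality.

Local Open Scope classical_set_scope.
Local Open Scope card_scope.

(** The subsets [C] of [A] such that every set equipotent to [C] is finite with
    the same number as [C] form an inductive system in [A], which is all of
    [power_set A] because [A] is finite.  In the inductive step, a bijection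
    from [B] onto [C `|` [set a]] with [~ C a] restricts to one from [B] minus
    the preimage of [a] onto [C]. *)

Lemma card_eq_setU1 {T U : Type} {B : set U} {C : set T} {a : T} :
  ~ C a -> B #= C `|` [set a] -> exists2 b, B b & B `\ b #= C.
Proof.
(* A total [f : U -> T] needs a default value outside [B], hence a pointed [T]; the point [a]
   excludes the empty case. *)
elim/Ppointed: T C a => T C a; first by case: (no a).
move=> nCa /card_set_bijP[f fbij]; have [_ finj fsurj] := fbij.
have [b Bb fb] := fsurj a (or_intror erefl).
exists b => //; apply/card_set_bijP; exists f.
have -> : B `\ b = B `\` f @^-1` [set a].
  apply/seteqP; split=> x [Bx nx]; split=> //= xE; apply: nx.
    by apply: finj; rewrite ?inE //= xE.
  by rewrite /= xE.
apply: bij_sub_setUrl fbij; apply/disj_setPS => x [Cx xa].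
by apply: nCa; rewrite -xa.
Qed.

(** The subsets of [A] satisfying [P] form an inductive system, so [A] is among them. *)
Lemma is_finite_ind {T : Type} {A : set T} (P : set T -> Prop) :
    is_finite A -> P set0 ->
    (forall C a, P C -> ~ C a -> P (C `|` [set a])) ->
  P A.
Proof.
move=> finA P0 PS; pose K : set (set T) := [set C | C `<=` A /\ P C].
have KE : K = power_set A.
  apply/(finA K); split=> [C [] // | | C a [CA PC] [Aa nCa]]; first by split.
  by split; [move=> x [/CA | ->] | apply: PS].
by have [] : K A by rewrite KE.
Qed.

Lemma iterator_equipotent {S : counting_system} {num : assignment (carrier S)}
    {T : Type} (U : Type) {A : set T} (finA : is_finite A) :
    is_iterator num ->
  forall B : set U, B #= A ->
    exists finB : is_finite B, num U B finB = num T A finA.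
Proof.
(* The finiteness proofs are part of [P], so that the inductive step can build both by
   [is_finite_setU1], the form in which [numS] applies. *)
move=> [num0 numS]; pose P (C : set T) := exists finC : is_finite C,
  forall B : set U, B #= C ->
    exists finB : is_finite B, num U B finB = num T C finC.
have [|C a [finC IH] nCa|finA' numA] := @is_finite_ind T A P finA.
- exists (is_finite_set0 (T := T)) => B; rewrite card_eq0 => /eqP ->.
  by exists (is_finite_set0 (T := U)); rewrite !num0.
- exists (is_finite_setU1 a finC) => B /(card_eq_setU1 nCa)[b Bb /IH[finBb numBb]].
  have -> : B = B `\ b `|` [set b].
    by rewrite setUC setDUK // => x ->.
  by exists (is_finite_setU1 b finBb); rewrite !numS ?numBb // => -[_ []].
(* The induction yields its own proof [finA'], identified with [finA] by proof irrelevance. *)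
by rewrite (Prop_irrelevance finA finA').
Qed.

Theorem proposition3p1 (S : counting_system) (num : assignment (carrier S))
    (num_iterator : is_iterator num) (T U : Type) (A : set T) (B : set U)
    (finA : is_finite A) (finB : is_finite B) :
  B #= A -> num U B finB = num T A finA.
Proof.
move=> /(iterator_equipotent U finA num_iterator)[finB' <-].
by rewrite (Prop_irrelevance finB finB').
Qed.
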